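(* Let $X,Y$ be locally compact Polish spaces and let $\pi:X\times Y\to\mathbb{R}$ be bounded and of Baire class 1. Then the best response relation $$E^\pi=\{(s,\mu)\in X\times\Delta(Y) : \forall t\in X\ \ \pi(s,\mu)\ge\pi(t,\mu)\}$$ is a Borel subset of $X\times\Delta(Y)$.
   Context: $\Delta(Y)$ is the Polish space of Borel probability measures on $Y$ (weak topology), and $\pi(s,\mu)=\int_Y\pi(s,y)\,d\mu(y)$. Baire class 1 means a pointwise limit of a sequence of continuous real-valued functions. *)

(* Defs.v *)
From HB Require Import structures.
From mathcomp Require Import all_boot all_order all_algebra.
From mathcomp Require Import all_classical all_reals all_analysis.
Set Implicit Arguments.
Unset Strict Implicit.
Unset Printing Implicit Defensive.
Import Order.TTheory GRing.Theory Num.Theory.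
Import numFieldNormedType.Exports.
Local Open Scope classical_set_scope.
Local Open Scope ring_scope.

Definition separable (T : topologicalType) : Prop :=
  exists2 D : set T, countable D & dense D.

(* Nonnegativity of d follows from the other metric axioms. *)
Definition completely_metrizable (R : realType) (T : topologicalType) : Prop :=
  exists d : T -> T -> R,
    [/\ forall x y, d x y = 0 <-> x = y,
        forall x y, d x y = d y x,
        forall x y z, d x z <= d x y + d y z,
        forall x (A : set T),
          nbhs x A <-> exists2 e : R, 0 < e & [set y | d x y < e] `<=` A
      & forall u : nat -> T,
          (forall e : R, 0 < e -> exists N : nat, forall m n : nat,
              (N <= m)%N -> (N <= n)%N -> d (u m) (u n) < e) ->
          exists l : T, u n @[n --> \oo] --> l].

Definition polish (R : realType) (T : topologicalType) : Prop :=
  separable T /\ completely_metrizable R T.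

Definition baire_class1 (R : realType) (T : topologicalType) (f : T -> R) :
    Prop :=
  exists2 g : nat -> T -> R,
    forall n, continuous (g n) & forall x, g n x @[n --> \oo] --> f x.

Definition borel_set (T : topologicalType) : set (set T) := <<s @open T >>.
Arguments borel_set : clear implicits.

(* Borel probability measures on Y. The library's measurable types are pointed,
   whence the ptopologicalType. *)
Definition Delta (R : realType) (Y : ptopologicalType) : Type :=
  probability (g_sigma_algebraType (@open Y)) R.

HB.instance Definition _ (R : realType) (Y : ptopologicalType) :=
  Choice.copy (Delta R Y) (probability (g_sigma_algebraType (@open Y)) R).

(* Weak topology on Delta R Y: the coarsest one making the maps
   mu |-> \int f d(mu) continuous, for every bounded continuous f : Y -> R. *)
Definition Cb (R : realType) (Y : ptopologicalType) : Type :=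
  {f : Y -> R | continuous f /\ bounded_fun f}.

Definition Delta_weak (R : realType) (Y : ptopologicalType) : Type :=
  sup_topology (fun f : Cb R Y =>
    Topological.class (initial_topology
      (fun mu : Delta R Y => \int[mu]_y sval f y : R))).

HB.instance Definition _ (R : realType) (Y : ptopologicalType) :=
  Topological.copy (Delta R Y) (Delta_weak R Y).

Definition expected_payoff (R : realType) (X : topologicalType)
    (Y : ptopologicalType) (payoff : X * Y -> R) (s : X) (mu : Delta R Y) : R :=
  \int[mu]_y payoff (s, y).

Definition best_response (R : realType) (X : topologicalType)
    (Y : ptopologicalType) (payoff : X * Y -> R) : set (X * Delta R Y) :=
  [set p | forall t : X,
     expected_payoff payoff p.1 p.2 >= expected_payoff payoff t p.2].

(* Main.v *)
(* Replacing the approximants g_n of the payoff by truncated ones multiplied by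
   compactly supported cutoffs in y, the maps (s, mu) |-> \int g_n(s, y) d mu(y)
   become jointly continuous (tube lemma), and they converge pointwise to the
   expected payoff by dominated convergence.  Hence
     H(t, (s, mu)) = pi(t, mu) - pi(s, mu)
   is of Baire class 1, so {H > 0} is an F_sigma set; as X is sigma-compact, its
   projection along t, which is the complement of the best response relation, is
   again F_sigma. *)
Require Import Defs.
From mathcomp Require Import all_boot all_order all_algebra.
From mathcomp Require Import all_classical all_reals all_analysis.
From mathcomp Require Import lra.
Import Order.TTheory GRing.Theory Num.Theory.
Import numFieldNormedType.Exports.
Local Open Scope classical_set_scope.
Local Open Scope ring_scope.

(** * Projections of Borel sets along a sigma-compact factor *)

Lemma borel_setC (T : topologicalType) (A : set T) :
  borel_set T A -> borel_set T (~` A).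
Proof.
move=> bA; rewrite -setTD.
by case: (smallest_sigma_algebra setT (@open T)) => _ + _; exact.
Qed.

Lemma closed_borel (T : topologicalType) (A : set T) :
  closed A -> borel_set T A.
Proof.
move=> cA; rewrite -[A]setCK; apply: borel_setC; apply: sub_sigma_algebra.
exact: closed_openC.
Qed.

(** Tube lemma: if [K] x {z} misses [C], the open complement of [C] is a neighbourhood of each (t,
    z), and compactness of [K] yields one neighbourhood of z that serves all t in [K]. *)
Lemma closed_compact_projection (X Z : topologicalType) (K : set X)
    (C : set (X * Z)) :
  compact K -> closed C -> closed [set z | exists2 t, K t & C (t, z)].
Proof.
move=> /compact_near_coveringP Kc /closed_openC oC.
rewrite -openC openE => z nz.
have : \forall w \near z, K `<=` (fun t => ~ C (t, w)).
  apply: Kc => t Kt.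
  have nC : ~ C (t, z) by move=> Ctz; apply: nz; exists t.
  have : nbhs (t, z) (~` C) by exact: open_nbhs_nbhs.
  by apply: filterS => -[].
by apply: filterS => w Kw [t Kt]; exact: Kw.
Qed.

(** The set where [H] is positive is the union over k, N of the closed sets [C k N]; cutting t down
    to [K m] keeps each projection closed, so countably many closed sets suffice. *)
Lemma borel_Baire1_projection (R : realType) (X Z : topologicalType)
    (K : nat -> set X) (H : X * Z -> R) :
  (forall n, compact (K n)) -> \bigcup_n K n = setT -> baire_class1 H ->
  borel_set Z [set z | exists t, 0 < H (t, z)].
Proof.
move=> Kc KT [h hc hH].
pose C k N := [set p | forall n, (N <= n)%N -> k.+1%:R^-1 <= h n p].
have Ccl k N : closed (C k N).
  rewrite (_ : C k N = \bigcap_(n in [set n | (N <= n)%N])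
      (h n @^-1` [set x | k.+1%:R^-1 <= x])).
    apply: closed_bigI => n _; apply: closed_comp; last exact: closed_ge.
    by move=> p _; exact: hc.
  by apply/seteqP; split => p.
rewrite (_ : [set z | _] = \bigcup_m \bigcup_k \bigcup_N
    [set z | exists2 t, K m t & C k N (t, z)]).
  apply: sigma_algebra_bigcup => m; apply: sigma_algebra_bigcup => k.
  apply: sigma_algebra_bigcup => N; apply: closed_borel.
  exact: closed_compact_projection (Kc m) (Ccl k N).
(* A strict bound 1/(k+1) < [H (t, z)] passes to [h n] for large n; conversely the limit keeps only
   the weak bound, which is still positive. *)
apply/seteqP; split => [z [t Htz]|z [m _ [k _ [N _ [t _ Ct]]]]].
  have [m _ Kt] : (\bigcup_n K n) t by rewrite KT.
  have [k] := ltr_add_invr Htz; rewrite add0r => kH.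
  have [N _ HN] : \forall n \near \oo, k.+1%:R^-1 < h n (t, z).
    by apply: (cvgr_gt _ (hH (t, z))).
  by exists m => //; exists k => //; exists N => //; exists t => // n /HN/ltW.
exists t; apply: (@lt_le_trans _ _ k.+1%:R^-1); first by rewrite invr_gt0.
by apply: (cvgr_to_ge (hH (t, z))); exists N => // n; exact: Ct.
Qed.

(** * Compactly supported cutoffs *)

Lemma metric_continuous (R : realType) (T : topologicalType) (d : T -> T -> R)
    (c : T) :
  (forall x y, d x y = d y x) ->
  (forall x y z, d x z <= d x y + d y z) ->
  (forall x (A : set T),
     nbhs x A <-> exists2 e : R, 0 < e & [set y | d x y < e] `<=` A) ->
  continuous (d c).
Proof.
move=> dsym dtri dnbhs x; apply/cvgrPdist_lt => e e0.
apply/dnbhs; exists e => //= y /= dxy.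
have := dtri c x y; have := dtri c y x; rewrite (dsym y x) => h1 h2.
rewrite ltr_norml; apply/andP; split; lra.
Qed.

(* Sums of tent functions supported by the compact closed balls with centre in
   the dense set and radius 1/(m+1); the interiors of these balls cover T. *)
Lemma lc_polish_cutoff (R : realType) (T : topologicalType) (x0 : T) :
  polish R T -> locally_compact [set: T] ->
  exists (phi : nat -> T -> R) (L : nat -> set T),
    [/\ forall n, continuous (phi n),
        forall n, compact (L n),
        forall n x, 0 <= phi n x <= 1,
        forall n x, ~ L n x -> phi n x = 0
      & forall x, \forall n \near \oo, phi n x = 1].
Proof.
move=> [[D /countable_injP[f finj] Dd] [d [d0 dsym dtri dnbhs _]]] lcT.
have dc c : continuous (d c) by exact: metric_continuous.
pose c k := xget x0 [set x | D x /\ f x = k].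
pose B (p : nat * nat) := [set y | d (c p.1) y <= p.2.+1%:R^-1].
pose A p := if pselect (compact (B p)) then B p else set0.
pose psi p y : R := if pselect (compact (B p))
  then Num.max 0 (1 - p.2.+1%:R * d (c p.1) y) else 0.
have Ac p : compact (A p) by rewrite /A; case: pselect => // ?; exact: compact0.
have psic p : continuous (psi p).
  rewrite /psi; case: pselect => [?|?] y; last exact: cvg_cst.
  apply: (@continuous_max R T (cst 0)
    (fun y => 1 - p.2.+1%:R * d (c p.1) y) y).
    exact: cvg_cst.
  apply: cvgB; first exact: cvg_cst.
  by apply: cvgM; [exact: cvg_cst|exact: dc].
have psi0 p y : 0 <= psi p y.
  by rewrite /psi; case: pselect => ? //; rewrite le_max lexx.
have psiA p y : ~ A p y -> psi p y = 0.
  rewrite /A /psi; case: pselect => // ? /negP.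
  rewrite -ltNge => h; apply/max_idPl; rewrite subr_le0.
  by rewrite -ler_pdivrMl ?ltr0Sn// mulr1 ltW.
have psi_cover y : exists p, 0 < psi p y.
  have [U yU [Uc _]] := lcT y I.
  have /dnbhs[e e0 eU] : nbhs y U by move: yU; rewrite withinET.
  (* With 1/(m+1) < e/2, a closed ball of radius 1/(m+1) about a centre closer than that to y stays
     in the e-ball of y, hence in the compact [U]; its tent is positive at y. *)
  have [m] := @ltr_add_invr R 0 (e / 2) ltac:(lra); rewrite add0r => me.
  have mp : 0 < m.+1%:R^-1 :> R by rewrite invr_gt0.
  have [||x [/= xm Dx]] := Dd [set z | d y z < m.+1%:R^-1].
  - by exists y => /=; rewrite (d0 y y).2.
  - rewrite (_ : [set z | _] = d y @^-1` [set r | r < m.+1%:R^-1]) //.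
    by apply: open_comp; [move=> z _; exact: dc|exact: open_lt].
  have cx : c (f x) = x.
    have [] : [set z | D z /\ f z = f x] (c (f x)).
      by apply: xgetPex; exists x.
    by move=> Dc; apply: finj; apply/mem_set.
  exists (f x, m); rewrite /psi; case: pselect => /= [_|[]].
    rewrite cx lt_max subr_gt0; apply/orP; right.
    by rewrite dsym -ltr_pdivlMl ?ltr0Sn// mulr1.
  apply: (subclosed_compact _ Uc).
    rewrite (_ : B _ = d (c (f x)) @^-1` [set r | r <= m.+1%:R^-1]) //.
    by apply: closed_comp; [move=> z _; exact: dc|exact: closed_le].
  move=> z; rewrite /B /= cx => xz; apply: eU => /=.
  by move: (m.+1%:R^-1) me xm xz (dtri y x z) => r; lra.
pose q j : nat * nat := odflt (0, 0)%N (choice.unpickle j).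
pose S n y := \sum_(j < n) psi (q j) y.
(* The factor n makes the value exactly 1 once the sum contains a tent positive at y and n exceeds
   the inverse of that tent's value. *)
exists (fun n y => Num.min 1 (n%:R * S n y)),
  (fun n => \big[setU/set0]_(j < n) A (q j)).
have S0 n y : 0 <= S n y by apply: sumr_ge0.
split.
- move=> n y; apply: (@continuous_min R T (cst 1) (fun y => n%:R * S n y) y).
    exact: cvg_cst.
  apply: cvgM; first exact: cvg_cst.
  apply: (@continuous_big R _ +%R 0 xpredT) => [z|j _].
    exact: add_continuous.
  exact: psic.
- by move=> n; apply: bigsetU_compact.
- move=> n y; rewrite ge_min lexx le_min ler01 /=.
  by rewrite andbT mulr_ge0.
- move=> n y nA; rewrite (_ : S n y = 0) ?mulr0 ?min_r//.
  apply: big1 => j _; apply: psiA => Aj; apply: nA.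
  by rewrite /= -(bigcup_mkord n (A \o q)); exists j => /=.
- move=> y; have [p pp] := psi_cover y.
  near=> n; apply/min_idPl.
  have jn : (choice.pickle p < n)%N by near: n; exact: nbhs_infty_gt.
  have Sn : psi p y <= S n y.
    rewrite /S (bigD1 (Ordinal jn)) //= {1}/q pickleK /= lerDl.
    exact: sumr_ge0.
  have nn : (psi p y)^-1 <= n%:R by near: n; exact: nbhs_infty_ger.
  apply: (@le_trans _ _ ((psi p y)^-1 * psi p y)).
    by rewrite mulVf//; exact: lt0r_neq0.
  apply: ler_pM => //.
  by rewrite invr_ge0; exact: ltW.
Unshelve. all: by end_near. Qed.

(** * Integrals of bounded functions and the weak topology *)

Lemma continuous_borel_measurable (R : realType) (Y : ptopologicalType)
    (f : Y -> R) :
  continuous f ->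
  measurable_fun setT (f : g_sigma_algebraType (@open Y) -> R).
Proof.
move=> fc.
apply: (measurability _ (measurable_realfun.RGenOInfty.measurableE R)).
move=> _ [_ [x ->] <-]; rewrite setTI; apply: sub_sigma_algebra.
by apply: open_comp; [move=> y _; exact: fc|exact: interval_open].
Qed.

Lemma norm_le_bounded_fun (R : realType) (T : Type) (f : T -> R) (M : R) :
  (forall x, `|f x| <= M) -> bounded_fun f.
Proof.
move=> fM; exists M; split; first exact: num_real.
by move=> r Mr x _ /=; exact: le_trans (fM x) (ltW Mr).
Qed.

Lemma probability_bounded_integrable (R : realType) (d : measure_display)
    (T : measurableType d) (mu : probability T R) (f : T -> R) (M : R) :
  measurable_fun setT f -> (forall y, `|f y| <= M) ->
  mu.-integrable setT (EFin \o f).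
Proof.
move=> mf fM; apply: measurable_bounded_integrable => //.
  by rewrite /= probability_setT ltry.
exact: (norm_le_bounded_fun _ _ _ M).
Qed.

Lemma Rintegral_dist_le (R : realType) (d : measure_display)
    (T : measurableType d) (mu : probability T R) (f g : T -> R) (e : R) :
  mu.-integrable setT (EFin \o f) -> mu.-integrable setT (EFin \o g) ->
  (forall y, `|f y - g y| <= e) ->
  `|\int[mu]_y f y - \int[mu]_y g y| <= e.
Proof.
move=> fi gi fge; rewrite -RintegralB//.
have fgi : mu.-integrable setT (EFin \o (fun y => f y - g y)).
  exact: (integrableB measurableT fi gi).
apply: (le_trans (le_normr_Rintegral _ fgi)) => //.
have ei : mu.-integrable setT (EFin \o cst e).
  exact: finite_measure_integrable_cst.
apply: (le_trans (le_Rintegral _ _ ei _)) => //.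
  exact: (integrable_norm fgi).
by rewrite Rintegral_cst//= probability_setT mulr1.
Qed.

Lemma Rintegral_bounded_cvg (R : realType) (d : measure_display)
    (T : measurableType d) (mu : probability T R) (h : nat -> T -> R)
    (f : T -> R) (M : R) :
  (forall n, measurable_fun setT (h n)) -> (forall n y, `|h n y| <= M) ->
  (forall y, h n y @[n --> \oo] --> f y) ->
  \int[mu]_y h n y @[n --> \oo] --> \int[mu]_y f y.
Proof.
move=> mh hM hf.
have mf : measurable_fun setT f.
  by apply: (measurable_realfun.measurable_fun_cvg mh) => y _; exact: hf.
have [] := @dominated_convergence _ _ _ mu setT measurableT
  (fun n => EFin \o h n) (EFin \o f) (EFin \o cst M).
- by move=> n; exact/measurable_realfun.measurable_EFinP.
- exact/measurable_realfun.measurable_EFinP.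
- by apply: aeW => y _; apply: cvg_EFin; [exact: nearW|exact: hf].
- exact: finite_measure_integrable_cst.
- by apply: aeW => y n _; rewrite /= lee_fin.
move=> fi _ hcvg; apply: fine_cvg; rewrite fineK//.
exact: integrable_fin_num.
Qed.

Lemma integral_weak_continuous (R : realType) (Y : ptopologicalType)
    (f : Y -> R) (M : R) :
  continuous f -> (forall y, `|f y| <= M) ->
  continuous (fun mu : Delta R Y => \int[mu]_y f y).
Proof.
move=> fc fM mu.
have fb : bounded_fun f by exact: (norm_le_bounded_fun _ _ _ M).
(* Convergence of [nbhs mu] to [mu] in the supremum topology gives convergence in the initial
   topology of this single [f]. *)
have [/(_ cvg_id (exist _ f (conj fc fb))) mucvg _] :=
  @cvg_sup (Delta R Y) (Cb R Y) (fun f : Cb R Y => Topological.class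
    (initial_topology (fun mu : Delta R Y => \int[mu]_y sval f y : R)))
    (nbhs mu) mu _.
apply: cvg_trans (cvg_app _ mucvg) _.
exact: (@initial_continuous _ _
  (fun mu : Delta R Y => \int[mu]_y f y : R)).
Qed.

(** Change the measure first, with s fixed: this is weak continuity. Then change s to t: as t tends
    to s the integrands converge uniformly, by compactness on [L] and trivially off it, so the error
    is uniform in the measure. *)
Lemma expected_payoff_continuous (R : realType) (X : topologicalType)
    (Y : ptopologicalType) (F : X * Y -> R) (L : set Y) (M : R) :
  continuous F -> (forall p, `|F p| <= M) -> compact L ->
  (forall x y, ~ L y -> F (x, y) = 0) ->
  continuous (fun p : X * Delta R Y => expected_payoff F p.1 p.2).
Proof.
move=> Fc FM /compact_near_coveringP Lc FL [s mu].
have Fsc t : continuous (fun y => F (t, y)).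
  move=> y; apply: (@continuous_comp _ _ _ (fun y => (t, y)) F); last exact: Fc.
  by apply: cvg_pair; [exact: cvg_cst|exact: cvg_id].
have Fi t (nu : Delta R Y) : nu.-integrable setT (EFin \o (fun y => F (t, y))).
  apply: (@probability_bounded_integrable _ _ _ nu _ M) => //.
  exact: continuous_borel_measurable.
apply/cvgrPdist_lt => e e0.
have e2 : 0 < e / 2 by lra.
have e4 : 0 < e / 2 / 2 by lra.
have unif : \forall t \near s,
    L `<=` (fun y => `|F (s, y) - F (t, y)| <= e / 2).
  (* Near (s, y), both F(s, y') and F(t, y') are within e/4 of F(s, y), hence within e/2 of each
     other. *)
  apply: Lc => y Ly.
  have /cvgrPdist_lt/(_ _ e4)[[A B] /= [sA yB] AB] := Fc (s, y).
  exists (B, A) => // -[y' t] /= [By' At].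
  have := AB (s, y') (conj (nbhs_singleton sA) By').
  have := AB (t, y') (conj At By') => /=.
  rewrite !ltr_norml ler_norml => /andP[? ?] /andP[? ?].
  by apply/andP; split; lra.
have muc := integral_weak_continuous _ _ _ _ (Fsc s) (fun y => FM (s, y)) mu.
move/cvgrPdist_lt/(_ _ e2) : muc => munear.
exists ([set t | L `<=` (fun y => `|F (s, y) - F (t, y)| <= e / 2)],
  [set nu : Delta R Y | `|\int[mu]_y F (s, y) - \int[nu]_y F (s, y)| < e / 2]).
  by split.
move=> [t nu] /= [tL nus].
have h1 : `|\int[nu]_y F (s, y) - \int[nu]_y F (t, y)| <= e / 2.
  apply: Rintegral_dist_le => // y.
  have [Ly|nLy] := pselect (L y); first exact: tL.
  by rewrite !FL// subrr normr0 ltW.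
rewrite /expected_payoff (splitr e).
rewrite -(subrK (\int[nu]_y F (s, y)) (\int[mu]_y F (s, y))) -addrA.
by apply: (le_lt_trans (ler_normD _ _)); exact: ltr_leD.
Qed.

(** Clipping to [-M, M] is continuous and fixes the values of [payoff], so it preserves the limit;
    so does a cutoff that is eventually 1 at each y. *)
Lemma baire_class1_truncated (R : realType) (X : topologicalType)
    (Y : ptopologicalType) (payoff : X * Y -> R) :
  polish R Y -> locally_compact [set: Y] ->
  bounded_fun payoff -> baire_class1 payoff ->
  exists (F : nat -> X * Y -> R) (L : nat -> set Y) (M : R),
    [/\ forall n, continuous (F n), forall n p, `|F n p| <= M,
        forall n, compact (L n),
        forall n x y, ~ L n y -> F n (x, y) = 0
      & forall p, F n p @[n --> \oo] --> payoff p].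
Proof.
move=> polY lcY pb [g gc gp].
have [M M0 /= pM] := ex_strict_bound_gt0 pb.
have [phi [L [phic Lc phi01 phiL phi1]]] := lc_polish_cutoff _ _ point polY lcY.
pose clip (r : R) := Num.max (- M) (Num.min M r).
have clipc : continuous clip.
  move=> r; apply: (@continuous_max R R (cst (- M)) (fun r => Num.min M r) r).
    exact: cvg_cst.
  by apply: (@continuous_min R R (cst M) id r); [exact: cvg_cst|exact: cvg_id].
have clipM r : `|clip r| <= M.
  by rewrite ler_norml le_max lexx /= ge_max ge_min lexx /= andbT; lra.
have clip_id p : clip (payoff p) = payoff p.
  have := pM p I; rewrite ltr_norml => /andP[h1 h2].
  by rewrite /clip min_r ?max_r ?ltW.
exists (fun n p => phi n p.2 * clip (g n p)), L, M; split => //.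
- move=> n p; apply: cvgM.
    apply: (@continuous_comp _ _ _ snd (phi n)).
      exact: cvg_snd.
    exact: phic.
  by apply: (@continuous_comp _ _ _ (g n) clip); [exact: gc|exact: clipc].
- move=> n p; have /andP[h0 h1] := phi01 n p.2.
  by rewrite normrM (ger0_norm h0) -[leRHS]mul1r ler_pM.
- by move=> n x y /phiL ->; rewrite mul0r.
- move=> p; rewrite -[payoff p]mul1r -clip_id; apply: cvgM.
    by apply: cvg_near_cst; exact: phi1.
  by apply: continuous_cvg; [exact: clipc|exact: gp].
Qed.

Theorem theorem7p9 (R : realType) (X : topologicalType) (Y : ptopologicalType)
  (polishX : polish R X) (lcX : locally_compact [set: X])
  (polishY : polish R Y) (lcY : locally_compact [set: Y])
  (payoff : X * Y -> R)
  (payoff_bounded : bounded_fun payoff)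
  (payoff_baire1 : baire_class1 payoff) :
  borel_set (X * Delta R Y)%type (best_response payoff).
Proof.
(* The cutoffs on [X] need a base point, so empty [X] is treated apart. *)
have [[x0 _]|X0] := pselect (exists x : X, True); last first.
  apply: closed_borel; rewrite (_ : best_response payoff = set0).
    exact: closed0.
  by apply/seteqP; split => // -[s mu] _; apply: X0; exists s.
have [phi [K [_ Kc _ phiK phi1]]] := lc_polish_cutoff _ _ x0 polishX lcX.
(* Sigma-compactness of [X]: each x has some cutoff equal to 1 there, which forces x into the
   corresponding compact set. *)
have KT : \bigcup_n K n = setT.
  apply/seteqP; split => // x _; have [N _ /(_ N (leqnn N)) pN] := phi1 x.
  exists N => //; apply: contrapT => /phiK; rewrite pN => /eqP.
  by rewrite oner_eq0.
have [F [L [M [Fc FM Lc FL Fp]]]] :=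
  baire_class1_truncated _ _ _ _ polishY lcY payoff_bounded payoff_baire1.
pose G n (p : X * Delta R Y) := expected_payoff (F n) p.1 p.2.
have Gc n : continuous (G n).
  exact: (expected_payoff_continuous _ _ _ _ _ _ (Fc n) (FM n) (Lc n) (FL n)).
have Gp s (mu : Delta R Y) :
    G n (s, mu) @[n --> \oo] --> expected_payoff payoff s mu.
  apply: (@Rintegral_bounded_cvg _ _ _ mu (fun n y => F n (s, y)) _ M) => //.
  move=> n; apply: continuous_borel_measurable => y.
  apply: (@continuous_comp _ _ _ (fun y => (s, y)) (F n)); last exact: Fc.
  by apply: cvg_pair; [exact: cvg_cst|exact: cvg_id].
pose H (q : X * (X * Delta R Y)) :=
  expected_payoff payoff q.1 q.2.2 - expected_payoff payoff q.2.1 q.2.2.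
rewrite (_ : best_response payoff = ~` [set p | exists t, 0 < H (t, p)]).
  apply: borel_setC; apply: (borel_Baire1_projection _ _ _ K) => //.
  exists (fun n q => G n (q.1, q.2.2) - G n q.2).
    move=> n q; apply: cvgB.
      apply: (@continuous_comp _ _ _ (fun q => (q.1, q.2.2)) (G n)).
        apply: (@cvg_pair _ _ _ _ (nbhs q.1) (nbhs q.2.2)).
          exact: cvg_fst.
        by apply: (@continuous_comp _ _ _ snd snd); exact: cvg_snd.
      exact: Gc.
    by apply: (@continuous_comp _ _ _ snd (G n)); [exact: cvg_snd|exact: Gc].
  by move=> [t [s mu]]; apply: cvgB; exact: Gp.
apply/seteqP; split => [p pbr [t]|p np t].
  by rewrite /H /= subr_gt0 ltNge pbr.
by rewrite leNgt; apply/negP => lt; apply: np; exists t; rewrite /H subr_gt0.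
Qed.
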